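(* Let $X$ be a Banach space. Then $\widetilde{T}(X)=T(X)$, where $$\widetilde{T}(X)=\sup\left\{\frac{2\|x\|^{1/2}\|y\|^{1/2}}{\|x+y\|}: x,y\in X,\ (x,y)\neq(0,0),\ x\perp_I y\right\}$$ and $$T(X)=\sup_{x,y\in S_X}\bigl(\|x+y\|\,\|x-y\|\bigr)^{1/2}.$$
   Context: $S_X=\{x\in X:\|x\|=1\}$ is the unit sphere of $X$. Isosceles orthogonality: $x\perp_I y$ means $\|x+y\|=\|x-y\|$. *)

(* Defs.v *)
From mathcomp Require Import all_boot all_order all_algebra.
From mathcomp Require Import all_classical all_reals all_analysis.
From mathcomp Require Import complex.
Set Implicit Arguments.
Unset Strict Implicit.
Unset Printing Implicit Defensive.
Import Order.TTheory GRing.Theory Num.Theory.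
Import numFieldNormedType.Exports.

Local Open Scope classical_set_scope.
Local Open Scope ring_scope.

(* MathComp norms take values in the scalar field. To treat real and complex
   spaces uniformly, the notions below take the real-valued norm N of X as an
   argument; it is [real_norm] over R and [complex_norm] over R[i]. *)

Definition real_norm (R : realType) (X : normedModType R) (x : X) : R := `|x|.

(* The norm of a vector, as an element of R[i], is a nonnegative real, so Re
   only changes its type. *)
Definition complex_norm (R : realType) (X : normedModType R[i]) (x : X) : R :=
  complex.Re `|x|.

Section Constants.
Variables (R : realType) (X : zmodType) (N : X -> R).

Definition unit_sphere : set X := [set x | N x = 1].

Definition isosceles_orthogonal (x y : X) : Prop := N (x + y) = N (x - y).

(* Suprema are taken in the extended reals, so that they always exist. The
   denominator vanishes only if x + y = x - y = 0, i.e. (x, y) = (0, 0). *)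
Definition T_tilde : \bar R :=
  ereal_sup [set r : \bar R | exists x y : X,
    [/\ (x, y) <> (0, 0), isosceles_orthogonal x y &
        r = (2 * Num.sqrt (N x) * Num.sqrt (N y) / N (x + y))%:E]].

Definition T_const : \bar R :=
  ereal_sup [set r : \bar R | exists x y : X,
    [/\ unit_sphere x, unit_sphere y &
        r = (Num.sqrt (N (x + y) * N (x - y)))%:E]].

End Constants.

(* Main.v *)
Require Import Defs.
From mathcomp Require Import all_boot all_order all_algebra.
From mathcomp Require Import all_classical all_reals all_analysis.
From mathcomp Require Import complex.
From mathcomp Require Import ring.
Import Order.TTheory GRing.Theory Num.Theory.
Import numFieldNormedType.Exports.
Local Open Scope ring_scope.

(** Up to scaling, (x, y) |-> (x + y, x - y) exchanges pairs of unit vectors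
    with isosceles orthogonal pairs: isosceles orthogonality says that x + y and
    x - y have the same norm, and applying the map twice doubles (x, y). The two
    quantities agree along this correspondence, so both suprema are taken over
    the same set. *)

(* The scalars K are R or R[i], with iota the inclusion of R. *)
Lemma T_tilde_eq_T_const (R : realType) (K : numFieldType)
    (iota : {rmorphism R -> K}) (X : lmodType K) (N : X -> R)
    (N_ge0 : forall x, 0 <= N x) (N_eq0 : forall x, N x = 0 -> x = 0)
    (NZ : forall (a : R) x, 0 <= a -> N (iota a *: x) = a * N x) :
  T_tilde N = T_const N.
Proof.
have dbl (x : X) : x + x = iota 2 *: x.
  by rewrite rmorph_nat scaler_nat mulr2n.
have addDB (x y : X) : (x + y) + (x - y) = iota 2 *: x.
  by rewrite addrACA subrr addr0 dbl.
have subDB (x y : X) : (x + y) - (x - y) = iota 2 *: y.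
  by rewrite opprB addrC addrA subrK dbl.
rewrite /T_tilde /T_const; congr ereal_sup; apply/seteqP.
split=> _ [x [y [Hx Hy ->]]] /=.
(* Otherwise orthogonality gives [x - y] norm 0 as well, and then 2x = 2y = 0. *)
- have c_neq0 : N (x + y) != 0.
    apply/eqP => c0; apply: Hx.
    have sum0 := N_eq0 _ c0.
    have diff0 : x - y = 0 by apply: N_eq0; rewrite -Hy.
    have two_neq0 : iota 2 != 0 by rewrite fmorph_eq0 pnatr_eq0.
    have /eqP := addDB x y; have /eqP := subDB x y.
    rewrite sum0 diff0 subr0 addr0 ![0 == _]eq_sym !scaler_eq0.
    by rewrite (negbTE two_neq0) => /eqP -> /eqP ->.
  have ci_ge0 : 0 <= (N (x + y))^-1 by rewrite invr_ge0.
  (* By orthogonality a single factor normalizes both vectors. *)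
  exists (iota (N (x + y))^-1 *: (x + y)), (iota (N (x + y))^-1 *: (x - y)).
  split; rewrite /unit_sphere /=.
  + by rewrite NZ // mulVf.
  + by rewrite NZ // -Hy mulVf.
  + rewrite -scalerDr -scalerBr addDB subDB !NZ //.
    congr (_%:E); set c := (N (x + y))^-1.
    have -> : c * (2 * N x) * (c * (2 * N y)) = (c * 2) ^+ 2 * (N x * N y).
      by ring.
    rewrite sqrtrM ?sqr_ge0 // sqrtr_sqr ger0_norm ?mulr_ge0 //.
    by rewrite sqrtrM // mulrC !mulrA.
- exists (x + y), (x - y); split.
  + case=> sum0 diff0; have := addDB x y; rewrite sum0 diff0 addr0 => /esym x0.
    have := NZ 2 x (ler0n _ 2); rewrite x0 Hx mulr1.
    (* So far [N 0 = 2], as 2x = 0 with [x] a unit vector; homogeneity at the scalar 0 gives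
       [N 0 = 0]. *)
    have <- : iota 0 *: x = 0 by rewrite rmorph0 scale0r.
    by rewrite NZ // mul0r => /eqP; rewrite eq_sym pnatr_eq0.
  + by rewrite /isosceles_orthogonal addDB subDB !NZ // Hx Hy.
  (* The denominator is the norm of 2x, which is 2 and cancels the leading 2. *)
  + rewrite addDB NZ // Hx mulr1 sqrtrM //.
    by congr (_%:E); field.
Qed.

Theorem theorem2p15 (R : realType) :
  (forall X : completeNormedModType R,
     T_tilde (@real_norm R X) = T_const (@real_norm R X)) /\
  (forall X : completeNormedModType R[i],
     T_tilde (@complex_norm R X) = T_const (@complex_norm R X)).
Proof.
split=> X.
- apply: (@T_tilde_eq_T_const R R idfun X) => [x|x|a x a0].
  + exact: normr_ge0.
  + exact: normr0_eq0.
  + by rewrite /real_norm /= normrZ ger0_norm.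
(* Norm values in [R[i]] are real, so taking [Re] loses nothing and identities transfer through the
   embedding of [R]. *)
- have normE (x : X) : `|x| = (complex_norm x)%:C%C.
    by rewrite /complex_norm RRe_real // normr_real.
  apply: (@T_tilde_eq_T_const R R[i] (real_complex R) X) => [x|x Nx0|a x a0].
  + by rewrite -ler0c -normE normr_ge0.
  + by apply: normr0_eq0; rewrite normE Nx0.
  + apply: complexI; rewrite -normE normrZ normE rmorphM /=.
    by rewrite ger0_norm // ler0c.
Qed.
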